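(* Let $\mathcal{C}$ be an $[n,k,d]_{q^m/q}$ code. If $\mathcal{C}$ is rank-nondegenerate, then $n\le km$ and, as $q\to+\infty$, $$\mathbb{E}^{\mathrm{rk}}[q^{n-\mathcal{C}^*}]\sim\begin{cases}1 & \text{if } n\le m-1,\\ q^{n-m} & \text{if } m+1\le n\le km,\\ 2 & \text{if } n=m.\end{cases}$$ If in addition $\mathcal{C}$ is rank-2-nondegenerate, then $n\le mk/2$, and for $k\ge3$ and $q\to+\infty$ we have $$\mathrm{Var}^{\mathrm{rk}}[q^{n-\mathcal{C}^*}]\sim\begin{cases}q^{-m+n+1} & \text{if } k\le n\le m-2 \text{ or } m+2\le n\le mk/2,\\ 1 & \text{if } n=m-1,\\ q & \text{if } n=m,\\ q^2 & \text{if } n=m+1.\end{cases}$$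
   Context: Let $q$ be a prime power and $n,m,k$ positive integers. For $v\in\mathbb{F}_{q^m}^n$ and an ordered basis $\Gamma=(\gamma_1,\dots,\gamma_m)$ of $\mathbb{F}_{q^m}$ over $\mathbb{F}_q$, let $\Gamma(v)\in\mathbb{F}_q^{n\times m}$ be the matrix with $v_i=\sum_{j}\Gamma(v)_{ij}\gamma_j$. The rank support $\sigma^{\mathrm{rk}}(v)\subseteq\mathbb{F}_q^n$ is the column space of $\Gamma(v)$ (independent of $\Gamma$), and $\mathrm{rk}(v)=\dim_{\mathbb{F}_q}\sigma^{\mathrm{rk}}(v)$. An $[n,k,d]_{q^m/q}$ code is a $k$-dimensional $\mathbb{F}_{q^m}$-subspace $\mathcal{C}\subseteq\mathbb{F}_{q^m}^n$ whose minimum rank distance, i.e. the minimum rank of its nonzero codewords, equals $d$; the zero code in $\mathbb{F}_{q^m}^n$ has minimum rank distance $n+1$ by convention. The code is rank-nondegenerate if $\sum_{v\in\mathcal{C}}\sigma^{\mathrm{rk}}(v)=\mathbb{F}_q^n$. With $\mathcal{C}^\perp=\{v\in\mathbb{F}_{q^m}^n: u v^\top=0 \ \forall u\in\mathcal{C}\}$, the code $\mathcal{C}$ is rank-2-nondegenerate if $\mathcal{C}^\perp$ has minimum rank distance at least $3$. $\mathcal{C}^*$ denotes the random variable $\mathrm{rk}(v)$, where $v$ is a uniformly random nonzero codeword of $\mathcal{C}$; $\mathbb{E}^{\mathrm{rk}}$ and $\mathrm{Var}^{\mathrm{rk}}$ denote mean and variance (of the function $q^{n-\mathrm{rk}(v)}$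 here). The asymptotic statements are for fixed $n,m,k$, with $q$ ranging over prime powers tending to infinity and $\mathcal{C}$ a code over the corresponding field with the stated properties; $g\sim h$ means that the ratio $g/h$ tends to $1$.
   Formalization: The case n = m of the mean is stated for k ≥ 2 (for k = 1, n = m every nonzero codeword has rank n, so the mean is 1, not ~2), and n ≤ mk/2 is stated for m ≥ 2 (for m = 1 the code F_q^n, n ≥ 2, is rank-2-nondegenerate yet n > n/2). *)

(* Defs.v *)
From HB Require Import structures.
From mathcomp Require Import all_boot all_order all_algebra all_field.
From mathcomp Require Import all_classical all_reals all_analysis.

Set Implicit Arguments.
Unset Strict Implicit.
Unset Printing Implicit Defensive.

Import Order.TTheory GRing.Theory Num.Theory.
Import numFieldNormedType.Exports.

Local Open Scope ring_scope.

(* F plays the role of F_q (q = #|F|) and L that of F_{q^m}; the alias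
   finvect_type endows L with its finite type structure, so that one can sum
   over codewords. *)
Section RankMetric.

Variables (F : finFieldType) (L : fieldExtType F) (n : nat).

Implicit Types (C : {vspace 'rV[finvect_type L]_n}) (v : 'rV[finvect_type L]_n).

Definition expand_mx (m : nat) (G : m.-tuple L) v : 'M[F]_(n, m) :=
  \matrix_(i < n, j < m) coord G j (v 0 i).

Definition col_space (m : nat) (A : 'M[F]_(n, m)) : {vspace 'cV[F]_n} :=
  <<[seq col j A | j : 'I_m]>>%VS.

(* Any basis gives the same space: see rk_suppE. *)
Definition rk_supp v : {vspace 'cV[F]_n} :=
  col_space (expand_mx (vbasis {:L}) v).

Definition rk v : nat := \dim (rk_supp v).

(* Ranks are at most n, so the default value n.+1 of the minimum is reached
   exactly when S has no nonzero element. *)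
Definition min_rk_dist (S : {pred 'rV[finvect_type L]_n}) : nat :=
  \big[minn/n.+1]_(v : 'rV[finvect_type L]_n | (v \in S) && (v != 0)) rk v.

Definition is_code C (k d : nat) : Prop :=
  \dim C = k /\ min_rk_dist (mem C) = d.

Definition rk_nondegenerate C : Prop :=
  (\sum_(v : 'rV[finvect_type L]_n | v \in C) rk_supp v)%VS = fullv.

Definition dual_code C : {set 'rV[finvect_type L]_n} :=
  [set v | [forall u, (u \in C) ==> (u *m v^T == 0)]].

Definition rk2_nondegenerate C : Prop :=
  (3 <= min_rk_dist (mem (dual_code C)))%N.

Definition nonzero_codewords C : {set 'rV[finvect_type L]_n} :=
  [set v | (v \in C) && (v != 0)].

Lemma col_space_expand_sub (m1 m2 : nat) (G1 : m1.-tuple L) (G2 : m2.-tuple L)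
  v : basis_of {:L} G1 -> basis_of {:L} G2 ->
  (col_space (expand_mx G2 v) <= col_space (expand_mx G1 v))%VS.
Proof.
move=> b1 b2; apply/span_subvP => _ /mapP[j _ ->].
suff -> : col j (expand_mx G2 v) =
    \sum_(l < m1) coord G2 j G1`_l *: col l (expand_mx G1 v).
  by apply: rpred_sum => l _; apply/memvZ/memv_span/map_f; rewrite mem_enum.
apply/colP => i; rewrite summxE mxE mxE.
rewrite {1}(coord_basis b1 (memvf (v 0 i : L))) linear_sum /=.
by apply: eq_bigr => l _; rewrite linearZ !mxE mulrC.
Qed.

Lemma rk_suppE (m : nat) (G : m.-tuple L) v :
  basis_of {:L} G -> rk_supp v = col_space (expand_mx G v).
Proof.
move=> bG; have bL := vbasisP {:L}.
by apply/eqP; rewrite eqEsubv !col_space_expand_sub.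
Qed.

End RankMetric.

Section UniformMoments.

Variables (R : realType) (T : finType).

Definition unif_mean (A : {set T}) (f : T -> R) : R :=
  (\sum_(x in A) f x) / #|A|%:R.

Definition unif_var (A : {set T}) (f : T -> R) : R :=
  unif_mean A (fun x => (f x - unif_mean A f) ^+ 2).

End UniformMoments.

Section CodeMoments.

Variables (R : realType) (F : finFieldType) (L : fieldExtType F) (n : nat).

Definition rk_power (v : 'rV[finvect_type L]_n) : R :=
  #|F|%:R ^ (n%:Z - (rk v)%:Z).

Definition rk_mean (C : {vspace 'rV[finvect_type L]_n}) : R :=
  unif_mean (nonzero_codewords C) rk_power.

Definition rk_var (C : {vspace 'rV[finvect_type L]_n}) : R :=
  unif_var (nonzero_codewords C) rk_power.

End CodeMoments.

Definition asymp_equiv (R : realType) (g h : nat -> R) : Prop :=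
  ((fun i => g i / h i) @ \oo --> (1 : R))%classic.

(* Main.v *)
(** For a codeword [v], [q^(n - rk v)] counts the vectors [x] of [F^n] that are
    orthogonal to [v]. Hence the sum of [q^(n - rk v)] (resp. of its square) over the
    code counts incidences: each [x] (resp. pair [x, y]) contributes the number
    of codewords orthogonal to it. Nondegeneracy says that a nonzero [x] defines a
    nonzero linear form on the code, and rank-2-nondegeneracy that two
    [F]-independent vectors define two forms that are independent over the
    extension field. So these numbers are explicit, and with [Y = q^n],
    [Q = q^m], [N = Q^k] so are the mean and the variance:
      [mean = (N + (Y - 1) N / Q - Y) / (N - 1)],
      [var = (Y - 1) N (1 - 1/Q) / (N - 1)
               * ((q - 1) / Q - (Y - 1) (1 - 1/Q) / (N - 1))].
    The variance is equivalent to [q Y / Q] as soon as [n + m <= m k], which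
    covers all four cases. *)

Require Import Defs.
From HB Require Import structures.
From mathcomp Require Import all_boot all_order all_algebra all_field.
From mathcomp Require Import all_classical all_reals all_analysis.
From mathcomp Require Import ring zify.

Set Implicit Arguments.
Unset Strict Implicit.
Unset Printing Implicit Defensive.

Import Order.TTheory GRing.Theory Num.Theory.
Import numFieldNormedType.Exports.

Local Open Scope ring_scope.

(** * Ranks and cardinalities of row spaces and kernels *)

Lemma card_row_space (K : finFieldType) (p n : nat) (A : 'M[K]_(p, n)) :
  #|[set u : 'rV[K]_n | (u <= A)%MS]| = (#|K| ^ \rank A)%N.
Proof.
have inj : injective (fun c : 'rV[K]_(\rank A) => c *m row_base A).
  by move=> c d; apply: row_free_inj; apply: row_base_free.
rewrite -[X in (_ ^ X)%N]mul1n -card_mx -cardsT -(card_imset _ inj).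
apply: eq_card => u; rewrite inE; apply/idP/imsetP.
  by rewrite -(eq_row_base A) => /submxP[c ->]; exists c.
by case=> c _ ->; rewrite (submx_trans (submxMl _ _)) // eq_row_base.
Qed.

Lemma card_row_ker (K : finFieldType) (n p : nat) (A : 'M[K]_(n, p)) :
  #|[set u : 'rV[K]_n | u *m A == 0]| = (#|K| ^ (n - \rank A))%N.
Proof.
rewrite -mxrank_ker -card_row_space; apply: eq_card => u.
by rewrite !inE sub_kermx.
Qed.

(** The transposes of [A] and of a matrix [B] of basis vectors of the span have the same row space,
    and the rows of [B^T] are independent. *)
Lemma dim_col_space (K : finFieldType) (n p : nat) (A : 'M[K]_(n, p)) :
  \dim (col_space A) = \rank A.
Proof.
set W := col_space A; pose b := vbasis W.
pose B : 'M[K]_(n, \dim W) := \matrix_(i, j) b`_j i 0.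
have mulB c : B *m c = \sum_j c j 0 *: b`_j.
  apply/colP=> i; rewrite !mxE summxE; apply: eq_bigr => j _.
  by rewrite !mxE mulrC.
have AB : (A^T <= B^T)%MS.
  apply/row_subP => j; rewrite -tr_col -[X in (X <= _)%MS]trmxK.
  have cW : col j A \in W by apply/memv_span/map_f; rewrite mem_enum.
  have -> : col j A = B *m \col_l coord b l (col j A).
    rewrite mulB {1}(coord_vbasis cW); apply: eq_bigr => l _.
    by rewrite mxE.
  by rewrite trmx_mul trmxK submxMl.
have BA : (B^T <= A^T)%MS.
  apply/row_subP => j.
  have -> : row j B^T = (b`_j)^T by apply/rowP=> i; rewrite !mxE.
  have : b`_j \in W by apply/vbasis_mem/mem_nth; rewrite size_tuple.
  rewrite /W /col_space; set s := [seq _ | _ : _].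
  move=> /(coord_span (X := in_tuple s)) ->.
  rewrite linear_sum /=; apply: summx_sub => i _; rewrite linearZ /=.
  apply: scalemx_sub.
  have /mapP[l _ ->] : s`_i \in s by apply: mem_nth.
  by rewrite tr_col row_sub.
rewrite -mxrank_tr; apply/eqP; rewrite eqn_leq.
apply/andP; split; last by apply: leq_trans (mxrankS AB) (rank_leq_row _).
apply: leq_trans (mxrankS BA).
rewrite leq_eqVlt eq_sym -/(row_free _); apply/orP; left.
rewrite -kermx_eq0; apply/rowV0P => c; rewrite sub_kermx.
move=> /eqP/(congr1 trmx); rewrite trmx_mul trmxK trmx0 mulB => c0.
have /freeP fb := basis_free (vbasisP W).
by apply/rowP=> j; have := fb _ c0 j; rewrite !mxE.
Qed.

(** * Scalar extension from [F] to [L] and rank of a vector *)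

Section Lift.
Variables (F : finFieldType) (L : fieldExtType F).
Local Notation K := (finvect_type L).

Definition lift_mx (p n : nat) (X : 'M[F]_(p, n)) : 'M[K]_(p, n) :=
  map_mx (in_alg K) X.

Lemma lift_mx_tr (p n : nat) (X : 'M[F]_(p, n)) : lift_mx X^T = (lift_mx X)^T.
Proof. by rewrite /lift_mx map_trmx. Qed.

(** Coordinates are [F]-linear and the entries of [X] lie in [F], so expansion commutes with
    multiplication by [X]. *)
Lemma expand_mul (m n p : nat) (G : m.-tuple L) (v : 'rV[K]_n)
    (X : 'M[F]_(n, p)) :
  expand_mx G (v *m lift_mx X) = X^T *m expand_mx G v.
Proof.
apply/matrixP=> i j; rewrite !mxE linear_sum; apply: eq_bigr => l _.
by rewrite !mxE -scalerAr mulr1 linearZ.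
Qed.

Lemma expand_eq0 (m n : nat) (G : m.-tuple L) (v : 'rV[K]_n) :
  basis_of {:L} G -> (expand_mx G v == 0) = (v == 0).
Proof.
move=> bG; apply/eqP/eqP => [v0|->]; last first.
  by apply/matrixP=> i j; rewrite !mxE linear0.
apply/rowP=> i; rewrite mxE (coord_basis bG (memvf (v 0 i : L))).
apply: big1 => j _; have /matrixP/(_ i j) := v0.
by rewrite !mxE => ->; rewrite scale0r.
Qed.

Lemma rkE (n : nat) (v : 'rV[K]_n) : rk v = \rank (expand_mx (vbasis {:L}) v).
Proof. exact: dim_col_space. Qed.

Lemma rk_leq_length (n : nat) (v : 'rV[K]_n) : (rk v <= n)%N.
Proof. by rewrite rkE rank_leq_row. Qed.

Lemma rk_leq_degree (n : nat) (v : 'rV[K]_n) : (rk v <= \dim {:L})%N.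
Proof. by rewrite rkE rank_leq_col. Qed.

Lemma rk_mul_lift (n p : nat) (v : 'rV[K]_p) (X : 'M[F]_(p, n)) :
  (rk (v *m lift_mx X) <= p)%N.
Proof.
rewrite rkE expand_mul (leq_trans (mxrankM_maxl _ _)) // rank_leq_col //.
Qed.

(** Expanding [v] in a basis turns orthogonality to [x] into [x] lying in the left kernel of an
    [F]-matrix of rank [rk v]. *)
Lemma card_annihilator (n : nat) (v : 'rV[K]_n) :
  #|[set x : 'rV[F]_n | v *m lift_mx x^T == 0]| = (#|F| ^ (n - rk v))%N.
Proof.
rewrite rkE -card_row_ker; apply: eq_card => x; rewrite !inE.
by rewrite -(expand_eq0 _ (vbasisP {:L})) expand_mul trmxK.
Qed.

Lemma card_finvect : #|K| = (#|F| ^ \dim {:L})%N.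
Proof.
by rewrite -(@card_vspacef F K (Vector.class (K : vectType F))) card_vspace.
Qed.

End Lift.

(** * Counting the codewords orthogonal to given vectors *)

Lemma vspace_sub_hyperplane (K : fieldType) (r : nat) (W : {vspace 'rV[K]_r}) :
  (\dim W < r)%N ->
  exists2 a : 'cV[K]_r, a != 0 & forall w, w \in W -> w *m a = 0.
Proof.
move=> ltW; pose B := \matrix_(i < \dim W) (vbasis W)`_i.
(* [B] has fewer than [r] rows, so some nonzero vector is orthogonal to all of them. *)
have : kermx B^T != 0.
  rewrite -mxrank_eq0 mxrank_ker mxrank_tr subn_eq0 -ltnNge.
  exact: leq_ltn_trans (rank_leq_row _) ltW.
case/rowV0Pn => c; rewrite sub_kermx => /eqP cB c0.
exists c^T => [|w /coord_vbasis ->]; first by rewrite trmx_eq0.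
rewrite mulmx_suml big1 // => i _; rewrite -scalemxAl.
have -> : (vbasis W)`_i = row i B by rewrite rowK.
by rewrite -row_mul -[B]trmxK -trmx_mul cB trmx0 row0 scaler0.
Qed.

(** The hypothesis says that no nonzero linear form kills the image of [C] under [M]. This image is
    thus the whole space, and rank-nullity gives the size of the kernel. *)
Lemma card_code_ker (K : finFieldType) (n r : nat) (C : {vspace 'rV[K]_n})
    (M : 'M[K]_(n, r)) :
  (forall a : 'cV[K]_r, a != 0 -> exists2 v, v \in C & v *m (M *m a) != 0) ->
  (#|[set v : 'rV[K]_n | (v \in C) && (v *m M == 0)%R]| * #|K| ^ r
     = #|K| ^ \dim C)%N.
Proof.
move=> surj; pose f : 'Hom('rV[K]_n, 'rV[K]_r) := linfun (mulmxr M).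
have fE v : f v = v *m M by rewrite lfunE.
have -> : #|[set v : 'rV[K]_n | (v \in C) && (v *m M == 0)%R]|
    = (#|K| ^ \dim (C :&: lker f))%N.
  rewrite -card_vspace; apply: eq_card => v.
  by rewrite inE memv_cap memv_ker fE.
rewrite -expnD -(limg_ker_dim f C); congr (_ ^ (_ + _))%N.
apply/eqP; rewrite eqn_leq andbC; apply/andP; split.
  by rewrite (leq_trans (dimvS (subvf _))) // dimvf /dim /= mul1n.
rewrite leqNgt; apply/negP => /vspace_sub_hyperplane[a /surj[v vC va0] aW].
by move: va0; rewrite mulmxA -fE aW ?eqxx // memv_img.
Qed.

Lemma min_rk_dist_leq (F : finFieldType) (L : fieldExtType F) (n : nat)
    (S : {pred 'rV[finvect_type L]_n}) (v : 'rV[finvect_type L]_n) :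
  v \in S -> v != 0 -> (min_rk_dist S <= rk v)%N.
Proof.
(* The default [n.+1] is not neutral for [minn] on [nat], so the minimum is unfolded and handled by
   induction on the enumeration. *)
move=> vS v0; rewrite /min_rk_dist unlock /reducebig.
have : v \in index_enum 'rV[finvect_type L]_n by rewrite mem_index_enum.
elim: index_enum => //= u s IH; rewrite inE => /predU1P[<-|/IH le_s].
  by rewrite vS v0 geq_minl.
by case: ifP => // _; rewrite (leq_trans (geq_minr _ _)).
Qed.

Section Code.
Variables (F : finFieldType) (L : fieldExtType F) (n : nat).
Local Notation K := (finvect_type L).
Variable C : {vspace 'rV[K]_n}.

(** The vectors are the rows of [X], so that [r = 1] and [r = 2] are treated together. *)
Definition orth_codewords (r : nat) (X : 'M[F]_(r, n)) : {set 'rV[K]_n} :=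
  [set v | (v \in C) && (v *m lift_mx L X^T == 0)].

Lemma notin_dualP (w : 'rV[K]_n) :
  reflect (exists2 u, u \in C & u *m w^T != 0) (w \notin dual_code C).
Proof.
rewrite inE negb_forall; apply: (iffP existsP) => -[u].
  by rewrite negb_imply => /andP[]; exists u.
by exists u; rewrite negb_imply; apply/andP.
Qed.

(** A combination of the rows of [X] over the extension vanishes on [C] exactly when it lies in the
    dual; the hypothesis thus makes the rows independent as forms on [C]. *)
Lemma card_orth_codewords (r : nat) (X : 'M[F]_(r, n)) :
    (forall a : 'rV[K]_r, a != 0 -> a *m lift_mx L X \notin dual_code C) ->
  (#|orth_codewords X| * #|K| ^ r = #|K| ^ \dim C)%N.
Proof.
move=> ndual; apply: card_code_ker => a a0.
have /ndual/notin_dualP[u uC] : a^T != 0 by rewrite trmx_eq0.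
by rewrite trmx_mul trmxK lift_mx_tr; exists u.
Qed.

(** Such an [x] annihilates the rank support of every codeword, hence their sum, which is
    everything; the unit vectors then give each entry of [x]. *)
Lemma rk_nondegenerate_orth (x : 'rV[F]_n) : rk_nondegenerate C ->
  (forall v, v \in C -> v *m lift_mx L x^T = 0) -> x = 0.
Proof.
move=> ndC x_orth.
have /subvP sub : (fullv <= lker (linfun (mulmx x : 'cV[F]_n -> 'cV[F]_1)))%VS.
  rewrite -ndC; apply/subv_sumP => v /x_orth vx.
  apply/span_subvP => _ /mapP[j _ ->]; rewrite memv_ker lfunE /=.
  have: expand_mx (vbasis {:L}) (v *m lift_mx L x^T) = 0.
    by rewrite vx; apply/eqP; rewrite expand_eq0 ?eqxx ?vbasisP.
  by rewrite expand_mul trmxK => xG; rewrite colE mulmxA xG mul0mx.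
apply/rowP=> i; have := sub (delta_mx i 0) (memvf _).
by rewrite memv_ker lfunE /= -colE => /eqP/colP/(_ 0); rewrite !mxE.
Qed.

(** A nonzero 1 by 1 coefficient only rescales the form given by [x], which is nonzero by
    nondegeneracy. *)
Lemma card_orth_vector (x : 'rV[F]_n) : rk_nondegenerate C -> x != 0 ->
  (#|orth_codewords x| * #|K| = #|K| ^ \dim C)%N.
Proof.
move=> ndC x0; rewrite -[X in (_ * X)%N]expn1.
apply: card_orth_codewords => a a0; apply/notin_dualP.
have [u uC ux] : exists2 u, u \in C & u *m lift_mx L x^T != 0.
  apply/exists2P; apply: contraNP x0 => /forallNP all_orth.
  apply/eqP/rk_nondegenerate_orth => // v vC; apply/eqP.
  by have /not_andP[//|/negP] := all_orth v; rewrite negbK.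
exists u => //; rewrite [a]mx11_scalar mul_scalar_mx linearZ -scalemxAr.
rewrite scaler_eq0 negb_or; apply/andP; split; last by rewrite lift_mx_tr in ux.
by apply: contraNneq a0 => a00; rewrite [a]mx11_scalar a00 raddf0.
Qed.

(** A combination of two vectors of [F^n] over the extension has rank at most 2, so it is too light
    for the dual unless it is zero. Independence over [F] persists over the extension, which
    excludes zero. *)
Lemma card_orth_pair (x y : 'rV[F]_n) : rk2_nondegenerate C ->
  row_free (col_mx x y) ->
  (#|orth_codewords (col_mx x y)| * #|K| ^ 2 = #|K| ^ \dim C)%N.
Proof.
move=> nd2 fX; apply: card_orth_codewords => a a0.
apply/negP => adual.
have/(min_rk_dist_leq adual) : a *m lift_mx L (col_mx x y) != 0.
  by apply: contra a0; rewrite mulmx_free_eq0 // row_free_map.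
by apply/negP; rewrite -ltnNge (leq_trans _ nd2) // ltnS rk_mul_lift.
Qed.
End Code.

Lemma row_free_col_mx2 (K : fieldType) (n : nat) (x y : 'rV[K]_n) :
  x != 0 -> ~~ (y <= x)%MS -> row_free (col_mx x y).
Proof.
move=> x0 yx; rewrite /row_free eqn_leq rank_leq_row /= -addsmxE.
have /rank_ltmx : (x < x + y)%MS.
  by rewrite ltmxE addsmxSl addsmx_sub submx_refl.
by rewrite rank_rV x0.
Qed.

(** * Exact mean and variance, and bounds on the length *)

Lemma unif_varE (R : realType) (T : finType) (A : {set T}) (f : T -> R) :
    #|A|%:R != 0 :> R ->
  unif_var A f = unif_mean A (fun x => f x ^+ 2) - unif_mean A f ^+ 2.
Proof.
move=> A0; rewrite /unif_var; set mu := unif_mean A f.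
have muE : \sum_(x in A) f x = mu * #|A|%:R by rewrite divfK.
rewrite /unif_mean; under eq_bigr do rewrite sqrrB.
rewrite big_split sumrB /= sumr_const sumrMnl -mulr_suml muE.
by rewrite -[mu ^+ 2 *+ _]mulr_natr; field.
Qed.

Section Moments.
Variables (R : realType) (F : finFieldType) (L : fieldExtType F) (n : nat).
Local Notation K := (finvect_type L).
Variable C : {vspace 'rV[K]_n}.
Local Notation q := (#|F|%:R : R).
Local Notation Q := (#|K|%:R : R).
Local Notation N := (#|K|%:R ^+ \dim C : R).
Local Notation orth v x := (v *m lift_mx L x^T == 0).

Lemma card_field_gt0 : 0 < q.
Proof. by rewrite ltr0n; apply/card_gt0P; exists 0. Qed.
Let q_gt0 := card_field_gt0.

Lemma card_ext_field : Q = q ^+ \dim {:L}.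
Proof. by rewrite card_finvect natrX. Qed.

Lemma card_ext_field_gt0 : 0 < Q.
Proof. by rewrite card_ext_field exprn_gt0. Qed.
Let Q_gt0 := card_ext_field_gt0.

Lemma rk_powerE (v : 'rV[K]_n) :
  rk_power R v = \sum_(x : 'rV[F]_n) (orth v x)%:R.
Proof.
rewrite /rk_power subzn ?rk_leq_length // -exprnP -natrX -card_annihilator.
rewrite -sum1_card natr_sum big_mkcond; apply: eq_bigr => x _.
by rewrite inE; case: (orth v x).
Qed.

Lemma sum_code_nat (P : pred 'rV[K]_n) :
  \sum_(v in C) (P v)%:R = #|[set v | (v \in C) && P v]|%:R :> R.
Proof.
rewrite -sum1_card natr_sum [RHS](eq_bigl (fun v => (v \in C) && P v)).
  by rewrite big_mkcondr; apply: eq_bigr => v _; case: (P v).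
by move=> v; rewrite inE.
Qed.

Lemma card_code : #|[set v in C]|%:R = N.
Proof.
by rewrite -natrX -card_vspace; congr _%:R; apply: eq_card => v; rewrite inE.
Qed.

Lemma card_orth0 : #|orth_codewords C (0 : 'rV[F]_n)|%:R = N.
Proof.
rewrite -card_code; congr _%:R; apply: eq_card => v.
by rewrite !inE trmx0 /lift_mx map_mx0 mulmx0 eqxx andbT.
Qed.

Lemma card_nonzero_rV : #|[pred x : 'rV[F]_n | x != 0]|%:R = q ^+ n - 1.
Proof.
have -> : #|[pred x : 'rV[F]_n | x != 0]| = (#|F| ^ n - 1)%N.
  by rewrite -[in RHS](mul1n n) -card_mx subn1 -(cardC1 (0 : 'rV[F]_n)).
by rewrite natrB ?natrX // expn_gt0 -(ltr0n R) q_gt0.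
Qed.

(** After exchanging the sums, [x = 0] contributes the whole code and each other [x] a hyperplane of
    it. *)
Lemma sum_rk_power : rk_nondegenerate C ->
  \sum_(v in C) rk_power R v = N + (q ^+ n - 1) * (N / Q).
Proof.
move=> ndC; under eq_bigr do rewrite rk_powerE.
rewrite exchange_big (bigD1 0) //=; congr (_ + _).
  by rewrite sum_code_nat card_orth0.
rewrite (eq_bigr (fun=> N / Q)) => [|x x0]; last first.
  rewrite sum_code_nat; apply: (canRL (mulfK (lt0r_neq0 Q_gt0))).
  by rewrite -natrM card_orth_vector // natrX.
rewrite sumr_const -[LHS]mulr_natl; congr (_ * _); exact: card_nonzero_rV.
Qed.

Lemma mem_orth_pair (x y : 'rV[F]_n) (v : 'rV[K]_n) :
  (v \in orth_codewords C (col_mx x y)) = [&& v \in C, orth v x & orth v y].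
Proof.
by rewrite inE tr_col_mx /lift_mx map_row_mx mul_mx_row row_mx_eq0.
Qed.

Lemma orth_multiple (x y : 'rV[F]_n) (v : 'rV[K]_n) :
  (y <= x)%MS -> orth v x -> orth v y.
Proof.
move=> /submxP[c ->] /eqP vx.
by rewrite trmx_mul /lift_mx map_mxM mulmxA vx mul0mx.
Qed.

(** The pairs with [x = 0] give back the first moment. For [x != 0], the [q] multiples [y] of [x]
    impose no further condition and contribute [N / Q] each; the other [q ^+ n - q] vectors
    contribute [N / Q ^+ 2] each. *)
Lemma sum_rk_power_sqr : rk_nondegenerate C -> rk2_nondegenerate C ->
  \sum_(v in C) rk_power R v ^+ 2
    = N + (q ^+ n - 1) * (N / Q)
      + (q ^+ n - 1) * (q * (N / Q) + (q ^+ n - q) * (N / Q ^+ 2)).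
Proof.
move=> ndC nd2.
have -> : \sum_(v in C) rk_power R v ^+ 2 =
    \sum_(x : 'rV[F]_n) \sum_(y : 'rV[F]_n) #|orth_codewords C (col_mx x y)|%:R.
  transitivity (\sum_(v in C) \sum_(x : 'rV[F]_n) \sum_(y : 'rV[F]_n)
      (orth v x && orth v y)%:R : R).
    apply: eq_bigr => v _; rewrite expr2 rk_powerE mulr_suml.
    apply: eq_bigr => x _; rewrite mulr_sumr; apply: eq_bigr => y _.
    by rewrite -natrM mulnb.
  rewrite exchange_big; apply: eq_bigr => x _; rewrite exchange_big.
  apply: eq_bigr => y _; rewrite sum_code_nat; congr _%:R.
  by apply: eq_card => v; rewrite mem_orth_pair !inE.
rewrite (bigD1 0) //=; congr (_ + _).
  rewrite -sum_rk_power //; under [RHS]eq_bigr do rewrite rk_powerE.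
  rewrite exchange_big; apply: eq_bigr => y _; rewrite sum_code_nat.
  congr _%:R; apply: eq_card => v; rewrite mem_orth_pair !inE.
  by rewrite trmx0 /lift_mx map_mx0 mulmx0 eqxx.
rewrite (eq_bigr (fun=> q * (N / Q) + (q ^+ n - q) * (N / Q ^+ 2))).
  rewrite sumr_const -[LHS]mulr_natl; congr (_ * _); exact: card_nonzero_rV.
move=> x x0; rewrite (bigID (fun y => (y <= x)%MS)) /=.
have card_line : #|[set y : 'rV[F]_n | (y <= x)%MS]| = #|F|.
  by rewrite card_row_space rank_rV x0.
congr (_ + _).
  rewrite (eq_bigr (fun=> N / Q)) => [|y yx].
    by rewrite sumr_const -[LHS]mulr_natl -card_line cardsE.
  apply: (canRL (mulfK (lt0r_neq0 Q_gt0))).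
  rewrite -(natrX R) -(card_orth_vector ndC x0) natrM; congr (_%:R * _).
  apply: eq_card => v; rewrite mem_orth_pair inE; congr (_ && _).
  by apply: andb_idr; apply: orth_multiple.
rewrite (eq_bigr (fun=> N / Q ^+ 2)) => [|y yx].
  rewrite sumr_const -[LHS]mulr_natl; congr (_ * _).
  rewrite -[X in _ = _ - X](congr1 (GRing.natmul 1) card_line).
  rewrite -natrX -[X in (_ ^ X)%N]mul1n -card_mx -natrB ?max_card //.
  rewrite -(cardsC [set y : 'rV[F]_n | (y <= x)%MS]) addKn.
  congr _%:R; apply: eq_card => y.
  by rewrite !inE.
have QQ : Q ^+ 2 != 0 by rewrite expf_neq0 ?lt0r_neq0.
apply: (canRL (mulfK QQ)).
by rewrite -!natrX -natrM card_orth_pair // row_free_col_mx2.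
Qed.

(** Since ranks are at most the degree, the second factor is a genuine power of [q], and
    [q ^+ n / Q] is a lower bound for all values. *)
Lemma rk_power_degree (v : 'rV[K]_n) :
  rk_power R v = q ^+ n / Q * q ^+ (\dim {:L} - rk v).
Proof.
rewrite /rk_power card_ext_field subzn ?rk_leq_length // -exprnP.
have q0 := lt0r_neq0 q_gt0.
apply: (mulIf (expf_neq0 (rk v) q0)); rewrite -[RHS]mulrA -!exprD.
by rewrite !subnK ?rk_leq_length ?rk_leq_degree // divfK ?expf_neq0.
Qed.

Lemma rk_power0 : rk_power R (0 : 'rV[K]_n) = q ^+ n.
Proof.
have -> : rk_power R (0 : 'rV[K]_n) = \sum_(x : 'rV[F]_n) 1.
  by rewrite rk_powerE; apply: eq_bigr => x _; rewrite mul0mx eqxx.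
by rewrite sumr_const card_mx mul1n natrX.
Qed.

Lemma sum_nonzero_codewords (f : 'rV[K]_n -> R) :
  \sum_(v in nonzero_codewords C) f v = \sum_(v in C) f v - f 0.
Proof.
rewrite [in RHS](bigD1 0) ?mem0v //= addrC addrK.
by apply: eq_bigl => v; rewrite inE.
Qed.

Lemma card_nonzero_codewords : #|nonzero_codewords C|%:R = N - 1.
Proof.
have := sum_nonzero_codewords (fun=> 1).
rewrite !sumr_const => ->; congr (_ - _).
by rewrite -card_code cardsE.
Qed.

Lemma card_code_gt1 : (0 < \dim C)%N -> 1 < N.
Proof.
by move=> k_gt0; rewrite exprn_egt1 ?ltr1n ?finNzRing_gt1 // -lt0n.
Qed.

Lemma rk_mean_closed : rk_nondegenerate C ->
  rk_mean R C = (N + (q ^+ n - 1) * (N / Q) - q ^+ n) / (N - 1).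
Proof.
move=> ndC; rewrite /rk_mean /unif_mean card_nonzero_codewords.
by rewrite sum_nonzero_codewords rk_power0 sum_rk_power.
Qed.

Lemma rk_var_closed :
    (0 < \dim C)%N -> rk_nondegenerate C -> rk2_nondegenerate C ->
  rk_var R C =
    (q ^+ n - 1) * N * (1 - Q^-1) / (N - 1)
      * ((q - 1) / Q - (q ^+ n - 1) * (1 - Q^-1) / (N - 1)).
Proof.
move=> k_gt0 ndC nd2.
have N1 : N - 1 != 0 by rewrite subr_eq0 gt_eqF // card_code_gt1.
have Q0 := lt0r_neq0 Q_gt0.
rewrite /rk_var unif_varE ?card_nonzero_codewords // -/(rk_mean R C).
rewrite rk_mean_closed // /unif_mean card_nonzero_codewords.
(* The zero codeword has the value [q ^+ n], whose square is removed from the second moment. *)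
rewrite sum_nonzero_codewords rk_power0 sum_rk_power_sqr //.
move: q Q N Q0 N1 (q ^+ n) => a b c b0 c1 y; field.
by rewrite c1.
Qed.

(* The rank of a codeword is at most the degree, so each value of q^(n - rk)
   is at least q^n / Q; averaging this bound gives the inequality. *)
Lemma rk_nondegenerate_length_le : rk_nondegenerate C -> (0 < \dim {:L})%N ->
  (n <= \dim C * \dim {:L})%N.
Proof.
move=> ndC m_gt0; rewrite mulnC.
suff : q ^+ n <= N.
  by rewrite card_ext_field -exprM ler_eXn2l // ltr1n finNzRing_gt1.
have Q1 : 1 < Q by rewrite ltr1n finNzRing_gt1.
have : 0 <= \sum_(v in nonzero_codewords C) (rk_power R v - q ^+ n / Q).
  apply: sumr_ge0 => v _; rewrite rk_power_degree -[X in _ <= _ - X]mulr1.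
  rewrite -mulrBr; apply: mulr_ge0; first by rewrite divr_ge0 ?exprn_ge0 ?ltW.
  by rewrite subr_ge0 exprn_ege1 // ler1n (ltnW (finNzRing_gt1 _)).
rewrite big_split /= sumr_const -[X in _ + X]mulr_natl card_nonzero_codewords.
rewrite sum_nonzero_codewords rk_power0 sum_rk_power //.
(* The sum factors through [N - q ^+ n], and the cofactor is positive because [Q > 1]. *)
have -> : N + (q ^+ n - 1) * (N / Q) - q ^+ n + (N - 1) * - (q ^+ n / Q)
    = (N - q ^+ n) * (1 - Q^-1) by field; apply: lt0r_neq0.
by rewrite pmulr_lge0 ?subr_ge0 // subr_gt0 invf_lt1.
Qed.

(* The values of q^(n - rk) on codewords are powers of q that are at least
   A := q^n / Q, so none lies strictly between the roots A and q A of the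
   quadratic averaged here. *)
Lemma rk2_nondegenerate_length_le : rk_nondegenerate C -> rk2_nondegenerate C ->
  (2 <= \dim {:L})%N -> (2 * n <= \dim C * \dim {:L})%N.
Proof.
move=> ndC nd2 m_gt1; rewrite mulnC [X in (_ <= X)%N]mulnC.
have q1 : 1 < q by rewrite ltr1n finNzRing_gt1.
have Q1 : 1 < Q by rewrite ltr1n finNzRing_gt1.
suff : q ^+ (n * 2) <= N by rewrite card_ext_field -exprM ler_eXn2l.
set A := q ^+ n / Q.
have : 0 <= \sum_(v in nonzero_codewords C)
              (rk_power R v ^+ 2 - (1 + q) * A * rk_power R v + q * A ^+ 2).
  apply: sumr_ge0 => v _; rewrite rk_power_degree -/A.
  (* Rank equal to the degree gives the root [A]. Otherwise the value is at least [q A], with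
     equality for [j = 0]. *)
  case: (\dim _ - _)%N => [|j].
    by rewrite [X in 0 <= X](_ : _ = 0) //; ring.
  have -> : (A * q ^+ j.+1) ^+ 2 - (1 + q) * A * (A * q ^+ j.+1) + q * A ^+ 2
      = A ^+ 2 * ((q ^+ j.+1 - 1) * (q * (q ^+ j - 1))).
    by rewrite (exprS q j); ring.
  have qX l : 1 <= q ^+ l by rewrite exprn_ege1 // ltW.
  apply: mulr_ge0 (sqr_ge0 _) _; apply: mulr_ge0; first by rewrite subr_ge0.
  by rewrite mulr_ge0 ?subr_ge0 // ltW.
rewrite big_split sumrB /= -mulr_sumr sumr_const -[X in _ + X]mulr_natl.
rewrite card_nonzero_codewords !sum_nonzero_codewords rk_power0.
rewrite sum_rk_power_sqr // sum_rk_power // exprM.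
have -> : N + (q ^+ n - 1) * (N / Q)
      + (q ^+ n - 1) * (q * (N / Q) + (q ^+ n - q) * (N / Q ^+ 2))
      - (q ^+ n) ^+ 2
    - (1 + q) * A * (N + (q ^+ n - 1) * (N / Q) - q ^+ n)
    + (N - 1) * (q * A ^+ 2)
    = (N - (q ^+ n) ^+ 2) * ((1 - Q^-1) * (1 - q / Q)).
  by rewrite /A; field; apply: lt0r_neq0.
(* The factor [1 - q / Q] is positive because the degree is at least 2; in degree 1 it would vanish
   and the sign would say nothing about [N]. *)
rewrite pmulr_lge0 ?subr_ge0 // mulr_gt0 // subr_gt0 ?invf_lt1 //.
rewrite ltr_pdivrMr // mul1r card_ext_field -[X in X < _]expr1.
by rewrite ltr_eXn2l.
Qed.
End Moments.

(** * Limits of the closed formulas as [q] tends to infinity *)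

(** The closed mean as a function of [x = q] alone, with [Q = x ^+ m] and [N = x ^+ (m * k)]. *)
Definition mean_formula (R : realType) (n m k : nat) (x : R) : R :=
  (x ^+ (m * k) + (x ^+ n - 1) * (x ^+ (m * k) / x ^+ m) - x ^+ n)
    / (x ^+ (m * k) - 1).

Definition var_formula (R : realType) (n m k : nat) (x : R) : R :=
  (x ^+ n - 1) * x ^+ (m * k) * (1 - (x ^+ m)^-1) / (x ^+ (m * k) - 1)
    * ((x - 1) / x ^+ m
       - (x ^+ n - 1) * (1 - (x ^+ m)^-1) / (x ^+ (m * k) - 1)).

Section Asymptotics.
Local Open Scope classical_set_scope.
Variables (R : realType) (q : nat -> R).
Hypotheses (q_gt1 : forall i, 1 < q i) (q_pinfty : q @ \oo --> +oo).

Let q_gt0 i : 0 < q i := lt_trans ltr01 (q_gt1 i).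

Lemma cvg_pow_ratio (a b : nat) : (a < b)%N ->
  (fun i => q i ^+ a / q i ^+ b) @ \oo --> (0 : R).
Proof.
move=> ltab.
have inv0 : (fun i => (q i)^-1) @ \oo --> (0 : R).
  by apply/gtr0_cvgV0 => //; apply: nearW.
have -> : (fun i => q i ^+ a / q i ^+ b) = (fun i => (q i)^-1 ^+ (b - a)).
  apply/funext => i; rewrite -[in LHS](subnK (ltnW ltab)) exprD exprVn.
  by rewrite invfM mulrCA divff ?mulr1 // expf_neq0 ?lt0r_neq0.
(* Writing the positive exponent as a successor starts the induction at the first power of the
   inverse. *)
have -> : (b - a)%N = (b - a.+1).+1 by rewrite subnS prednK // subn_gt0.
elim: (b - a.+1)%N => [//|j IH].
under eq_fun do rewrite exprS.
by rewrite -[0](mul0r (0 : R)); apply: cvgM.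
Qed.

Lemma cvg_pow_inv (b : nat) : (0 < b)%N ->
  (fun i => (q i ^+ b)^-1) @ \oo --> (0 : R).
Proof.
by move/cvg_pow_ratio; under eq_fun do rewrite expr0 mul1r.
Qed.

Lemma cvg_one_sub (f : nat -> R) : f @ \oo --> (0 : R) ->
  (fun i => 1 - f i) @ \oo --> (1 : R).
Proof.
move=> f0; rewrite -[1 in X in _ --> X](subr0 (1 : R)).
by apply: cvgB => //; apply: cvg_cst.
Qed.

Lemma cvg_inv_one_sub (f : nat -> R) : f @ \oo --> (0 : R) ->
  (fun i => (1 - f i)^-1) @ \oo --> (1 : R).
Proof.
move/cvg_one_sub => f1; rewrite -[1 in X in _ --> X](invr1 R).
by apply: cvgV; rewrite ?oner_neq0.
Qed.

Variables (n m k : nat).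
Hypotheses (n_gt0 : (0 < n)%N) (m_gt0 : (0 < m)%N) (k_gt0 : (0 < k)%N).

Let q_neq0 i l : q i ^+ l != 0.
Proof. by rewrite expf_neq0 ?lt0r_neq0. Qed.

Let N_neq1 i : q i ^+ (m * k) - 1 != 0.
Proof. by rewrite subr_eq0 gt_eqF // exprn_egt1 // -lt0n muln_gt0 m_gt0. Qed.

Lemma cvg_mean_formula_lt : (n < m)%N ->
  (fun i => mean_formula n m k (q i)) @ \oo --> (1 : R).
Proof.
move=> ltnm.
have -> : (fun i => mean_formula n m k (q i)) = (fun i =>
    (1 + q i ^+ n / q i ^+ m - (q i ^+ m)^-1 - q i ^+ n / q i ^+ (m * k))
      * (1 - (q i ^+ (m * k))^-1)^-1).
  apply/funext => i; have := N_neq1 i; have := q_neq0 i (m * k).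
  have := q_neq0 i m; rewrite /mean_formula.
  move: (q i ^+ n) (q i ^+ m) (q i ^+ (m * k)) => y b c b0 c0 c1.
  by field; rewrite c0 b0 c1.
rewrite -[1 in X in _ --> X](mulr1 (1 : R)); apply: cvgM; last first.
  by apply/cvg_inv_one_sub/cvg_pow_inv; rewrite muln_gt0 m_gt0.
rewrite -[1 in X in _ --> X](addr0 (1 : R)).
rewrite -[X in _ --> X]subr0 -[X in _ --> X]subr0.
apply: cvgB; first apply: cvgB; first apply: cvgD.
- exact: cvg_cst.
- exact: cvg_pow_ratio.
- exact: cvg_pow_inv.
by apply: cvg_pow_ratio; rewrite (leq_trans ltnm) // leq_pmulr.
Qed.

(** Here [q ^+ n / q ^+ m] is 1, whence the limit 2. The bound on [k] makes [q ^+ m / q ^+ (m * k)]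
    vanish; for [k = 1] it would equal 1 and the limit would be 1. *)
Lemma cvg_mean_formula_eq : n = m -> (2 <= k)%N ->
  (fun i => mean_formula n m k (q i)) @ \oo --> (2 : R).
Proof.
move=> eqnm k_gt1.
have -> : (fun i => mean_formula n m k (q i)) = (fun i =>
    (1 + 1 - (q i ^+ m)^-1 - q i ^+ m / q i ^+ (m * k))
      * (1 - (q i ^+ (m * k))^-1)^-1).
  apply/funext => i; have := N_neq1 i; have := q_neq0 i (m * k).
  have := q_neq0 i m; rewrite /mean_formula eqnm.
  move: (q i ^+ m) (q i ^+ (m * k)) => b c b0 c0 c1.
  by field; rewrite c0 b0 c1.
rewrite -[2 in X in _ --> X](mulr1 (2 : R)); apply: cvgM; last first.
  by apply/cvg_inv_one_sub/cvg_pow_inv; rewrite muln_gt0 m_gt0.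
rewrite -[X in _ --> X]subr0 -[X in _ --> X]subr0.
apply: cvgB; first apply: cvgB.
- exact: cvg_cst.
- exact: cvg_pow_inv.
by apply: cvg_pow_ratio; rewrite ltn_Pmulr.
Qed.

Lemma cvg_mean_formula_gt : (m < n)%N -> (2 <= k)%N ->
  (fun i => mean_formula n m k (q i) / (q i ^+ n / q i ^+ m)) @ \oo --> (1 : R).
Proof.
move=> ltmn k_gt1.
have -> : (fun i => mean_formula n m k (q i) / (q i ^+ n / q i ^+ m))
  = (fun i =>
    (1 + q i ^+ m / q i ^+ n - (q i ^+ n)^-1 - q i ^+ m / q i ^+ (m * k))
      * (1 - (q i ^+ (m * k))^-1)^-1).
  apply/funext => i; have := N_neq1 i; have := q_neq0 i (m * k).
  have := q_neq0 i m; have := q_neq0 i n; rewrite /mean_formula.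
  move: (q i ^+ n) (q i ^+ m) (q i ^+ (m * k)) => y b c y0 b0 c0 c1.
  by field; rewrite y0 c0 b0 c1.
rewrite -[1 in X in _ --> X](mulr1 (1 : R)); apply: cvgM; last first.
  by apply/cvg_inv_one_sub/cvg_pow_inv; rewrite muln_gt0 m_gt0.
rewrite -[1 in X in _ --> X](addr0 (1 : R)).
rewrite -[X in _ --> X]subr0 -[X in _ --> X]subr0.
apply: cvgB; first apply: cvgB; first apply: cvgD.
- exact: cvg_cst.
- exact: cvg_pow_ratio.
- exact: cvg_pow_inv.
by apply: cvg_pow_ratio; rewrite ltn_Pmulr.
Qed.

(** After division by the expected equivalent, the only delicate term is
    [q ^+ (n + m) / q ^+ (m * k).+1]: the hypothesis sends it to 0, and what remains tends to 1. *)
Lemma cvg_var_formula : (n + m < (m * k).+1)%N ->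
  (fun i => var_formula n m k (q i) / (q i * (q i ^+ n / q i ^+ m)))
    @ \oo --> (1 : R).
Proof.
move=> ltk.
have mk_gt0 : (0 < m * k)%N by rewrite muln_gt0 m_gt0.
have -> : (fun i => var_formula n m k (q i) / (q i * (q i ^+ n / q i ^+ m)))
  = (fun i => (1 - (q i ^+ (m * k))^-1)^-1 * (1 - (q i ^+ m)^-1)
      * (1 - (q i ^+ n)^-1) * (1 - (q i)^-1
        - q i ^+ (n + m) / q i ^+ (m * k).+1 * (1 - (q i ^+ n)^-1)
          * (1 - (q i ^+ m)^-1) * (1 - (q i ^+ (m * k))^-1)^-1)).
  apply/funext => i; have := N_neq1 i; have := q_neq0 i (m * k).
  have := q_neq0 i m; have := q_neq0 i n; have := q_neq0 i 1.
  rewrite /var_formula exprD (exprS _ (m * k)) expr1.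
  move: (q i ^+ n) (q i ^+ m) (q i ^+ (m * k)) (q i) => y b c x x0 y0 b0 c0 c1.
  by field; rewrite x0 y0 c0 b0 c1.
have cm := cvg_one_sub (cvg_pow_inv m_gt0).
have cn := cvg_one_sub (cvg_pow_inv n_gt0).
have cN := cvg_inv_one_sub (cvg_pow_inv mk_gt0).
rewrite -[1 in X in _ --> X](mulr1 (1 : R)); apply: cvgM.
  rewrite -[1 in X in _ --> X](mulr1 (1 : R)); apply: cvgM => //.
  by rewrite -[1 in X in _ --> X](mulr1 (1 : R)); apply: cvgM.
rewrite -[X in _ --> X]subr0; apply: cvgB.
  by have := cvg_one_sub (cvg_pow_inv (ltn0Sn 0)).
rewrite -[0](mul0r (1 : R)); apply: cvgM => //.
rewrite -[0](mul0r (1 : R)); apply: cvgM => //.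
rewrite -[0](mul0r (1 : R)); apply: cvgM => //.
exact: cvg_pow_ratio.
Qed.
End Asymptotics.

(** * Transfer to families of codes *)

Lemma expfzB_nat (K : fieldType) (x : K) (a b : nat) : x != 0 ->
  x ^ (a%:Z - b%:Z) = x ^+ a / x ^+ b.
Proof. by move=> x0; rewrite expfzDr // -exprnN. Qed.

Lemma rk_mean_formula (R : realType) (F : finFieldType) (L : fieldExtType F)
    (n : nat) (C : {vspace 'rV[finvect_type L]_n}) : rk_nondegenerate C ->
  rk_mean R C = mean_formula n (\dim {:L}) (\dim C) (#|F|%:R : R).
Proof. by move=> ndC; rewrite rk_mean_closed // card_ext_field -exprM. Qed.

Lemma rk_var_formula (R : realType) (F : finFieldType) (L : fieldExtType F)
    (n : nat) (C : {vspace 'rV[finvect_type L]_n}) :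
    (0 < \dim C)%N -> rk_nondegenerate C -> rk2_nondegenerate C ->
  rk_var R C = var_formula n (\dim {:L}) (\dim C) (#|F|%:R : R).
Proof.
by move=> k_gt0 ndC nd2; rewrite rk_var_closed // card_ext_field -exprM.
Qed.

Theorem proposition4p15 (R : realType) (n m k : nat)
    (n_gt0 : (0 < n)%N) (m_gt0 : (0 < m)%N) (k_gt0 : (0 < k)%N) :
  [/\ (forall (F : finFieldType) (L : fieldExtType F)
         (C : {vspace 'rV[finvect_type L]_n}) (d : nat),
         \dim {:L} = m -> is_code C k d -> rk_nondegenerate C ->
         (n <= k * m)%N),
      (forall (F : nat -> finFieldType) (L : forall i, fieldExtType (F i))
         (C : forall i, {vspace 'rV[finvect_type (L i)]_n}) (d : nat -> nat),
         ((fun i => #|F i|%:R : R) @ \oo --> +oo)%classic ->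
         (forall i, \dim {:L i} = m) ->
         (forall i, is_code (C i) k (d i)) ->
         (forall i, rk_nondegenerate (C i)) ->
         let q := fun i => #|F i|%:R : R in
         let mean := fun i => rk_mean R (C i) in
         [/\ ((n + 1 <= m)%N -> asymp_equiv mean (fun=> 1)),
             ((m + 1 <= n <= k * m)%N ->
                asymp_equiv mean (fun i => q i ^ (n%:Z - m%:Z)))
           & (n = m -> (2 <= k)%N -> asymp_equiv mean (fun=> 2))]),
      (forall (F : finFieldType) (L : fieldExtType F)
         (C : {vspace 'rV[finvect_type L]_n}) (d : nat),
         \dim {:L} = m -> is_code C k d -> rk_nondegenerate C ->
         rk2_nondegenerate C -> (2 <= m)%N -> (2 * n <= m * k)%N)
    & (forall (F : nat -> finFieldType) (L : forall i, fieldExtType (F i))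
         (C : forall i, {vspace 'rV[finvect_type (L i)]_n}) (d : nat -> nat),
         (3 <= k)%N ->
         ((fun i => #|F i|%:R : R) @ \oo --> +oo)%classic ->
         (forall i, \dim {:L i} = m) ->
         (forall i, is_code (C i) k (d i)) ->
         (forall i, rk_nondegenerate (C i)) ->
         (forall i, rk2_nondegenerate (C i)) ->
         let q := fun i => #|F i|%:R : R in
         let var := fun i => rk_var R (C i) in
         [/\ ((k <= n)%N && (n + 2 <= m)%N ||
              (m + 2 <= n)%N && (2 * n <= m * k)%N ->
                asymp_equiv var (fun i => q i ^ (- m%:Z + n%:Z + 1))),
             (n + 1 = m)%N -> asymp_equiv var (fun=> 1),
             n = m -> asymp_equiv var (fun i => q i)
           & (n = m + 1)%N -> asymp_equiv var (fun i => q i ^+ 2)])].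
Proof.
split.
- move=> F L C d mE [kE _] ndC.
  by rewrite -mE -kE rk_nondegenerate_length_le // mE.
- move=> F L C d q_pinfty mE codeC ndC q mean.
  have q_gt1 i : 1 < q i by rewrite ltr1n finNzRing_gt1.
  have meanE i : mean i = mean_formula n m k (q i).
    by have [kE _] := codeC i; rewrite /mean rk_mean_formula // mE kE.
  have q0 i : q i != 0 by rewrite gt_eqF // (lt_trans ltr01).
  split.
  + rewrite addn1 /asymp_equiv => ltnm.
    under eq_fun do rewrite meanE divr1.
    exact: cvg_mean_formula_lt.
  + rewrite addn1 /asymp_equiv => /andP[ltmn le_n].
    under eq_fun do rewrite meanE expfzB_nat ?q0 //.
    apply: cvg_mean_formula_gt => //.
    (* The range [m < n <= k * m] forces [k] to be at least 2. *)
    by rewrite ltnNge; apply/negP => k_le1; nia.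
  + move=> eqnm k_gt1; rewrite /asymp_equiv.
    (* The limit 1 is written [2 / 2], to divide the limit of the mean by the constant. *)
    rewrite -[1 in X in (_ --> X)%classic](@divff _ (2 : R)) //.
    under eq_fun do rewrite meanE.
    by apply: cvgM; [exact: cvg_mean_formula_eq | exact: cvg_cst].
- move=> F L C d mE [kE _] ndC nd2 m_gt1.
  by rewrite -mE -kE [X in (_ <= X)%N]mulnC rk2_nondegenerate_length_le // mE.
move=> F L C d k_gt2 q_pinfty mE codeC ndC nd2 q var.
have q_gt1 i : 1 < q i by rewrite ltr1n finNzRing_gt1.
have varE i : var i = var_formula n m k (q i).
  by have [kE _] := codeC i; rewrite /var rk_var_formula // ?mE kE.
(* The four cases are one equivalent evaluated at different [n]. *)
have var_equiv (h : nat -> R) : (n + m < (m * k).+1)%N ->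
    (forall i, h i = q i * (q i ^+ n / q i ^+ m)) -> asymp_equiv var h.
  move=> ltk hE; rewrite /asymp_equiv; under eq_fun do rewrite varE hE.
  exact: cvg_var_formula.
have q0 i : q i != 0 by rewrite gt_eqF // (lt_trans ltr01).
(* For [n <= m + 1], [n + m <= 2 m + 1 <= 3 m <= m k]. For [n >= m + 2], the length bound gives
   [n + m < 2 n <= m k]. *)
have mk : (m * 3 <= m * k)%N by rewrite leq_mul2l k_gt2 orbT.
split=> [range|eqnm|eqnm|eqnm]; apply: var_equiv => [|i].
- by case/orP: range => /andP[? ?]; lia.
- by rewrite expfzDr // [- _ + _]addrC expfzB_nat // mulrC expr1z.
- lia.
- by rewrite -eqnm addn1 mulrA -exprS divff ?expf_neq0.
- lia.
- by rewrite eqnm divff ?mulr1 // expf_neq0.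
- lia.
- by rewrite eqnm exprD expr1 mulrAC divff ?expf_neq0 // mul1r expr2.
Qed.
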